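(* Fix $\epsilon>0$ and $\alpha\in(1,\infty)$. For each prior $\rho$ and pair $(s_i,s_j)\in\mathbb{S}$, let $\pi^*_{i,j,\rho}$ be the comonotone coupling of $P_{X|s_i,\rho}$ and $P_{X|s_j,\rho}$ and suppose $\sigma^2_{i,j,\rho}>0$ satisfies $$\int e^{\alpha(\alpha-1)\frac{(x-x')^2}{2\sigma^2_{i,j,\rho}}}\,\mathrm{d}\pi^*_{i,j,\rho}(x,x')=e^{(\alpha-1)\epsilon}.$$ Let $\sigma^2$ be the maximum of $\sigma^2_{i,j,\rho}$ over all $(s_i,s_j)\in\mathbb{S}$ and all $\rho$ (assumed to exist). Then releasing $Y=X+N$ with $N$ Gaussian of mean $0$ and variance $\sigma^2$ (density $\frac{1}{\sqrt{2\pi}\sigma}e^{-z^2/(2\sigma^2)}$), independent of $(X,S)$, attains $(\alpha,\epsilon)$-Rényi pufferfish privacy.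
   Context: Setting: a sensitive secret $S$ and real-valued data $X$. For each secret value $s$ and each adversarial prior belief $\rho$ (ranging over a given set of priors), $X$ given $S=s$ has a density $P_{X|s,\rho}$ on $\mathbb{R}$. $\mathbb{S}$ is a given set of ordered secret pairs. The released data is $Y=X+N$ with $N$ independent of $(X,S)$, so $P_{Y|S}(y|s,\rho)=\int P_N(y-x)P_{X|S}(x|s,\rho)\,\mathrm{d}x$. For densities $P\ll Q$, $D_\alpha(P\|Q)=\frac{1}{\alpha-1}\log\int P^\alpha Q^{1-\alpha}$. $Y$ satisfies $(\alpha,\epsilon)$-Rényi pufferfish privacy if $D_\alpha(P_{Y|s_i,\rho}\|P_{Y|s_j,\rho})\le\epsilon$ for all $\rho$ and all $(s_i,s_j)\in\mathbb{S}$. The comonotone (Kantorovich optimal) coupling of two distributions on $\mathbb{R}$ with CDFs $F_i,F_j$ is the joint distribution with joint CDF $\min\{F_i(x),F_j(x')\}$, i.e. the law of $(F_i^{-1}(U),F_j^{-1}(U))$, $U\sim\mathrm{Unif}(0,1)$. *)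

(* Defs.v *)
From HB Require Import structures.
From mathcomp Require Import all_boot all_order all_algebra.
From mathcomp Require Import all_classical all_reals all_analysis.
Set Implicit Arguments. Unset Strict Implicit. Unset Printing Implicit Defensive.
Import Order.TTheory GRing.Theory Num.Theory.
Import numFieldNormedType.Exports.
Local Open Scope classical_set_scope.
Local Open Scope ring_scope.

Section Defs.
Variable R : realType.
Notation leb := (@lebesgue_measure R).

Definition is_density (p : R -> R) : Prop :=
  (forall x, 0 <= p x) /\ measurable_fun setT p /\
  (\int[leb]_x (p x)%:E = 1)%E.

Definition cdf (p : R -> R) (x : R) : R :=
  fine (\int[leb]_(t in `]-oo, x%R]) (p t)%:E)%E.

Definition quantile (p : R -> R) (u : R) : R :=
  inf [set x | u <= cdf p x].

(* integral of g against the comonotone coupling of the laws with densities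
   p and q: the law of (F_p^{-1}(U), F_q^{-1}(U)) with U ~ Unif(0,1) *)
Definition comonotone_integral (p q : R -> R) (g : R -> R -> R) : \bar R :=
  (\int[leb]_(u in `]0%R, 1%R[) (g (quantile p u) (quantile q u))%:E)%E.

Definition gauss (s2 : R) (z : R) : R :=
  (Num.sqrt (2 * pi) * Num.sqrt s2)^-1 * expR (- (z ^+ 2) / (2 * s2)).

(* density of Y = X + N, N with density pN independent of X with density pX *)
Definition conv_density (pN pX : R -> R) (y : R) : R :=
  fine (\int[leb]_x (pN (y - x) * pX x)%:E)%E.

Definition renyi_div (alpha : R) (P Q : R -> R) : \bar R :=
  match (\int[leb]_y (P y `^ alpha * Q y `^ (1 - alpha))%:E)%E with
  | r%:E => if 0 < r then (ln r / (alpha - 1))%:E else -oo%E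
  | +oo%E => +oo%E
  | -oo%E => -oo%E
  end.

Definition abs_cont (P Q : R -> R) : Prop :=
  leb.-negligible [set y | Q y = 0 /\ P y != 0].

Definition renyi_pufferfish (Sec Prior : Type) (SS : Sec -> Sec -> Prop)
    (PY : Sec -> Prior -> R -> R) (alpha eps : R) : Prop :=
  forall (rho : Prior) (si sj : Sec), SS si sj ->
    abs_cont (PY si rho) (PY sj rho) /\
    (renyi_div alpha (PY si rho) (PY sj rho) <= eps%:E)%E.
End Defs.

(* Main.v *)
Require Import Defs.
From HB Require Import structures.
From mathcomp Require Import all_boot all_order all_algebra.
From mathcomp Require Import all_classical all_reals all_analysis.
From mathcomp Require Import measurable_realfun ring lra.
Import Order.TTheory GRing.Theory Num.Theory.
Import numFieldNormedType.Exports.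
Local Open Scope ring_scope.

(* Let U be uniform on ]0, 1[ and let a, b be the quantile functions of the two
   conditional laws p, q.  As a(U) and b(U) have laws p and q, the densities of
   Y given either secret are the means of g(y - a(U)) and g(y - b(U)), with g
   the Gaussian density.  The perspective x^alpha y^(1 - alpha) of the convex
   function x^alpha is jointly convex, so Jensen's inequality bounds the Renyi
   integrand at y by the mean of g(y - a(U))^alpha g(y - b(U))^(1 - alpha).
   Integrating over y with Tonelli's theorem and completing the square gives
   the mean of exp(alpha (alpha - 1) (a(U) - b(U))^2 / (2 s2)), that is, the
   integral against the comonotone coupling, which decreases in s2. *)

(** * The law with a given density, and its quantile function *)

Section density_prob.
Local Open Scope classical_set_scope.
Context {R : realType} {p : R -> R}.
Notation leb := (@lebesgue_measure R).

(** Carrying [pd] in the term lets the measure and probability instances below, which rest on it, be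
    inferred. *)
Definition density_prob (pd : is_density p) :
    set (measurableTypeR R) -> \bar R :=
  fun A => (\int[leb]_(x in A) (p x)%:E)%E.

Hypothesis pd : is_density p.

Let p_ge0 x : (0 <= (p x)%:E)%E. Proof. by rewrite lee_fin; case: pd. Qed.

Let measurable_p D : measurable_fun D (fun x => (p x)%:E).
Proof. by apply/measurable_EFinP/measurable_funTS; case: pd => _ []. Qed.

Let density_prob0 : density_prob pd set0 = 0%E.
Proof. exact: integral_set0. Qed.

Let density_prob_ge0 A : (0 <= density_prob pd A)%E.
Proof. exact: integral_ge0. Qed.

Let density_prob_sigma_additive : semi_sigma_additive (density_prob pd).
Proof.
move=> F mF tF mUF; rewrite /density_prob; apply: cvg_toP.
  apply: ereal_nondecreasing_is_cvgn => m n mn.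
  by apply: lee_sum_nneg_natr => // k _ _; exact: integral_ge0.
by rewrite ge0_integral_bigcup//; exact: measurable_p.
Qed.

HB.instance Definition _ := isMeasure.Build _ _ _ (density_prob pd)
  density_prob0 density_prob_ge0 density_prob_sigma_additive.

Let density_probT : density_prob pd setT = 1%E.
Proof. by have [_ []] := pd. Qed.

HB.instance Definition _ :=
  Measure_isProbability.Build _ _ R (density_prob pd) density_probT.

Lemma density_prob_dominates : density_prob pd `<< leb.
Proof.
apply/null_content_dominatesP => A mA A0.
by apply: null_set_integral => //; exact: measurable_p.
Qed.

(** The Radon-Nikodym derivative of the law has the same integrals as [p] over measurable sets,
    hence equals [p] almost everywhere. *)
Lemma integral_density_prob (h : R -> \bar R) :
  measurable_fun setT h -> (forall x, 0 <= h x)%E ->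
  (\int[density_prob pd]_x h x = \int[leb]_x (h x * (p x)%:E))%E.
Proof.
move=> mh h0; have dom := density_prob_dominates.
have mf := Radon_Nikodym_SigmaFinite.f_integrable dom.
rewrite -(Radon_Nikodym_SigmaFinite.change_of_variables dom)//.
apply: ae_eq_integral => //.
- by apply: emeasurable_funM => //; exact: measurable_int mf.
- by apply: emeasurable_funM => //; exact: measurable_p.
- apply: ae_eqe_mul2l; apply: integral_ae_eq => //; first exact: measurable_p.
  by move=> E _ mE; rewrite -Radon_Nikodym_SigmaFinite.f_integral.
Qed.

Let idTR : measurableTypeR R -> R := idfun.

#[local] HB.instance Definition _ :=
  @isMeasurableFun.Build _ _ _ _ idTR (@measurable_id _ _ setT).

Let cdfE : Defs.cdf p = fine \o cdf (idTR : {RV (density_prob pd) >-> R}).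
Proof. by []. Qed.

Let cdf_fin x : cdf (idTR : {RV (density_prob pd) >-> R}) x \is a fin_num.
Proof. exact: fin_num_measure. Qed.

Lemma density_prob_itvNyc x : density_prob pd `]-oo, x] = (Defs.cdf p x)%:E.
Proof. by rewrite cdfE fineK ?cdf_fin. Qed.

Lemma density_cdf_ge0 x : 0 <= Defs.cdf p x.
Proof. by rewrite -lee_fin -density_prob_itvNyc. Qed.

Lemma density_cdf_le1 x : Defs.cdf p x <= 1.
Proof. by rewrite -lee_fin -density_prob_itvNyc probability_le1. Qed.

Lemma density_cdf_homo : {homo Defs.cdf p : x y / x <= y}.
Proof.
move=> x y xy; rewrite -lee_fin -!density_prob_itvNyc.
by apply: le_measure; rewrite ?inE//; exact: subitvPr.
Qed.

(** Galois connection between quantile and cdf: the limits of the cdf make the infimum a genuine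
    one, and right continuity makes it attained. *)
Lemma quantile_le (u x : R) : 0 < u < 1 ->
  (quantile p u <= x) = (u <= Defs.cdf p x).
Proof.
move=> /andP[u0 u1].
have [lo lou] : exists lo, Defs.cdf p lo < u.
  have : Defs.cdf p @ -oo%R --> (0:R).
    by rewrite cdfE; exact/fine_cvg/cvg_cdfNy0.
  move=> /cvgr_lt/(_ u u0) [M [_ +]] => /(_ (M - 1)) H.
  by exists (M - 1); apply: H; rewrite ltrBlDr ltrDl.
have [hi hiu] : exists hi, u <= Defs.cdf p hi.
  have : Defs.cdf p @ +oo%R --> (1:R) by rewrite cdfE; exact/fine_cvg/cvg_cdfy1.
  move=> /cvgr_gt/(_ u u1) [M [_ +]] => /(_ (M + 1)) H.
  by exists (M + 1); apply/ltW/H; rewrite ltrDl.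
have lb y z : Defs.cdf p z < u -> u <= Defs.cdf p y -> z <= y.
  move=> zu uy; rewrite leNgt; apply/negP => /ltW/density_cdf_homo.
  by rewrite leNgt (lt_le_trans zu).
apply/idP/idP => [qx|ux]; last first.
  by apply: ge_inf => //; exists lo => y /lb; exact.
rewrite leNgt; apply/negP => xu.
(* If the cdf is below [u] at [x], it stays so up to [x + e / 2], which is then a lower bound of the
   set, contradicting [qx]. *)
have : Defs.cdf p y @[y --> x^'+] --> Defs.cdf p x.
  rewrite cdfE; apply: fine_cvg.
  by rewrite fineK ?cdf_fin//; exact: cdf_right_continuous.
move=> /cvgr_lt/(_ u xu) [e /= e0 He].
have : x + e / 2 <= quantile p u.
  apply: lb_le_inf; first by exists hi.
  move=> y /lb; apply; apply: He => /=; last by rewrite ltrDl divr_gt0.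
  rewrite opprD addrA subrr add0r normrN gtr0_norm ?divr_gt0//.
  by rewrite ltr_pdivrMr// ltr_pMr// ltr1n.
by move=> /le_trans /(_ qx); rewrite gerDl leNgt divr_gt0.
Qed.

End density_prob.

(** * A probability on the line is determined by its cdf *)

Section prob_eq_itvNyc.
Local Open Scope classical_set_scope.
Context {R : realType}.

Let G : set (set R) := [set A | exists x, A = `]-oo, x]].

Let measurable_itvNyc : (@ocitv R).-sigma.-measurable = G.-sigma.-measurable.
Proof.
rewrite eqEsubset; split => A; apply: smallest_sub.
- exact: smallest_sigma_algebra.
- move=> _ [[a b] _ <-] /=.
  have -> : `]a, b]%classic = `]-oo, b] `\` `]-oo, a].
    by rewrite -[RHS]setCK setCD setCitvl setUC -[LHS]setCK setCitv.
  by apply: (@measurableD _ (g_sigma_algebraType G));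
    apply: sub_sigma_algebra; [exists b|exists a].
- exact: smallest_sigma_algebra.
- by move=> _ [x ->]; exact: measurable_itv.
Qed.

(** The half-lines form a generating pi-system that exhausts the line. *)
Lemma prob_eq_itvNyc (P Q : probability (measurableTypeR R) R) :
  (forall x, P `]-oo, x] = Q `]-oo, x]) -> forall A, measurable A -> P A = Q A.
Proof.
move=> PQ A mA; refine (@measure_unique _ R (measurableTypeR R)
  G (fun n => `]-oo, n%:R]) _ _ _ _ P Q _ _ A mA).
- exact: measurable_itvNyc.
- move=> _ _ [x ->] [y ->]; exists (Num.min x y).
  by apply/seteqP; split=> z /=; rewrite !in_itv/= le_min => /andP.
- by move=> n; exists n%:R.
- rewrite -subTset => x _; exists (Num.truncn x).+1 => //=.
  by rewrite in_itv/= ltW// truncnS_gt.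
- by move=> _ [x ->]; exact: PQ.
- by move=> n; rewrite (le_lt_trans (probability_le1 _ _)) ?ltry.
Qed.

End prob_eq_itvNyc.

(** * Inverse transform sampling *)

Section quantile_coupling.
Local Open Scope classical_set_scope.
Context {R : realType}.
Notation leb := (@lebesgue_measure R).
Notation unif01 := (uniform_prob (@ltr01 R)).

(** The uniform law lives on the closed interval, [comonotone_integral] on the open one; the
    endpoints are null. *)
Lemma integral_unif01 (f : R -> \bar R) :
  measurable_fun setT f -> (forall u, 0 <= f u)%E ->
  (\int[unif01]_u f u = \int[leb]_(u in `]0%R, 1%R[) f u)%E.
Proof.
move=> mf f0; rewrite integral_uniform// subr0 invr1 mul1e.
by rewrite integral_itv_bndoo//; exact: measurable_funTS.
Qed.

(* Cut off outside `]0, 1[, where the quantile is the infimum of a set that may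
   be empty or unbounded, hence a junk value. *)
Definition quantile01 {p : R -> R} (pd : is_density p) :
    measurableTypeR R -> measurableTypeR R :=
  quantile p \_ `]0, 1[.

Context {p : R -> R} (pd : is_density p).

Lemma measurable_quantile : measurable_fun (`]0, 1[ : set R) (quantile p).
Proof.
apply: (measurability (@RGenOInfty.G R)) => [|/= _ [_] [x] -> <-].
  exact: RGenOInfty.measurableE.
rewrite (_ : _ `&` _ = `]0, 1[ `&` `]Defs.cdf p x, +oo[);
  first exact: measurableI.
apply/seteqP; split=> u /= [u01]; rewrite !in_itv/= !andbT => xu;
  split=> //; rewrite in_itv/= in u01; move: xu;
  by rewrite !ltNge (quantile_le pd).
Qed.

Lemma measurable_quantile01 : measurable_fun setT (quantile01 pd).
Proof.
by apply/measurable_restrict => //; rewrite setTI; exact: measurable_quantile.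
Qed.

HB.instance Definition _ :=
  isMeasurableFun.Build _ _ _ _ (quantile01 pd) measurable_quantile01.

Lemma quantile01_law (A : set (measurableTypeR R)) : measurable A ->
  distribution unif01 (quantile01 pd) A = density_prob pd A.
Proof.
move=> mA; apply: (@prob_eq_itvNyc R (distribution unif01 (quantile01 pd))
  (density_prob pd)) => // x.
apply: etrans (esym (density_prob_itvNyc pd x)).
pose B := quantile01 pd @^-1` `]-oo, x].
have mB : measurable B by exact: measurable_funPTI.
transitivity (\int[unif01]_u (\1_B u)%:E)%E.
  by rewrite integral_indic// setIT.
rewrite integral_unif01//; last first.
  exact/measurable_EFinP/measurable_indic.
transitivity (\int[leb]_(u in `]0%R, 1%R[) (\1_(`]-oo, Defs.cdf p x]) u)%:E)%E.
  apply: eq_integral => u u01; congr (_%:E); rewrite !indicE; congr (_%:R).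
  congr nat_of_bool; apply: asbool_equiv_eq.
  rewrite /B /quantile01 /= patchE u01 !in_itv/=.
  by rewrite (quantile_le pd)//; rewrite inE/= in_itv in u01.
(* Passing to []0, 1]] makes the intersection below exactly []0, c]], even when [c = 1]. *)
rewrite -(@integral_itv_bndoo _ _ _ _ false false); last first.
  exact/measurable_EFinP/measurable_funTS/measurable_indic.
rewrite integral_indic//.
have := density_cdf_ge0 pd x; have := density_cdf_le1 pd x.
move: (Defs.cdf p x) => c c1 c0.
rewrite (_ : _ `&` _ = `]0, c]); last first.
  apply/seteqP; split=> u /=; rewrite !in_itv/=.
    by move=> [-> /andP[->]].
  by move=> /andP[-> uc]; rewrite uc (le_trans uc).
apply: etrans (lebesgue_measure_itv `]0%R, c]%R) _; rewrite /= lte_fin.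
case: ltP => [_|c0'].
  by rewrite sube0.
by congr (_%:E); apply/eqP; rewrite eq_le c0 c0'.
Qed.

Lemma integral_quantile01 (h : R -> \bar R) :
  measurable_fun setT h -> (forall x, 0 <= h x)%E ->
  (\int[unif01]_u h (quantile01 pd u) = \int[leb]_x (h x * (p x)%:E))%E.
Proof.
move=> mh h0; rewrite -(integral_density_prob pd)//.
rewrite -(ge0_integral_distribution
  (quantile01 pd : {RV unif01 >-> measurableTypeR R}))//.
by apply: eq_measure_integral => A mA _; exact: quantile01_law.
Qed.

End quantile_coupling.

(** * Jensen's inequality for the perspective of a power *)

Section renyi_convexity.
Local Open Scope classical_set_scope.
Context {R : realType}.
Implicit Types (a : R).

(* The right-hand term in [y] and the left-hand side form the tangent plane of
   the perspective along the ray [x = c * y]. *)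
Lemma powR_perspective a (x y c : R) : 1 < a -> 0 < x -> 0 < y -> 0 < c ->
  a * c `^ (a - 1) * x <= x `^ a * y `^ (1 - a) + (a - 1) * c `^ a * y.
Proof.
move=> a1 x0 y0 c0; have a0 : 0 < a by rewrite (lt_trans _ a1).
(* Dividing by $c^a y$ leaves an inequality in the single ratio [w]. *)
have [w w0 ->] : exists2 w, 0 < w & x = w * (c * y).
  exists (x / (c * y)); first by rewrite divr_gt0// mulr_gt0.
  by rewrite divfK// gt_eqF// mulr_gt0.
(* Young's inequality for [w] and [1], with conjugate exponents [a] and [a / (a - 1)]. *)
have aw : a * w <= w `^ a + (a - 1).
  have q0 : 0 < a / (a - 1) by rewrite divr_gt0// subr_gt0.
  have := conjugate_powR (ltW w0) ler01 a0 q0.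
  rewrite powR1 mulr1 mul1r invf_div -{1}(mul1r a^-1) -mulrDl.
  rewrite addrC subrK divff ?gt_eqF//.
  by move=> /(_ erefl); rewrite -mulrDl ler_pdivlMr// mulrC.
have -> : (w * (c * y)) `^ a * y `^ (1 - a) = w `^ a * (c `^ a * y).
  have [w0' c0' y0'] := And3 (ltW w0) (ltW c0) (ltW y0).
  rewrite powRM ?mulr_ge0// powRM// -!mulrA -powRD;
    last by rewrite (gt_eqF y0) implybT.
  by rewrite (addrC a) subrK powRr1// ltW.
have <- : c * c `^ (a - 1) = c `^ a by rewrite mulr_powRB1// ltW.
have k0 : 0 <= c * c `^ (a - 1) * y by rewrite !mulr_ge0 ?powR_ge0// ltW.
by have := ler_wpM2r k0 aw; move: (c `^ _) (w `^ _) => d v; lra.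
Qed.

(** Integrate the tangent plane along the ray through [(x, y)], where it touches the perspective. *)
Lemma powR_perspective_integral {d : measure_display} {T : measurableType d}
    (mu : {measure set T -> \bar R}) a (f g : T -> R) (x y : R) :
  1 < a -> 0 < x -> 0 < y ->
  measurable_fun setT f -> measurable_fun setT g ->
  (forall t, 0 < f t) -> (forall t, 0 < g t) ->
  (\int[mu]_t (f t)%:E = x%:E)%E -> (\int[mu]_t (g t)%:E = y%:E)%E ->
  ((x `^ a * y `^ (1 - a))%:E <= \int[mu]_t (f t `^ a * g t `^ (1 - a))%:E)%E.
Proof.
move=> a1 x0 y0 mf mg f0 g0 fx gy.
pose c := x / y; have c0 : 0 < c by rewrite divr_gt0.
have a0 : 0 < a by rewrite (lt_trans _ a1).
have mpow : measurable_fun setT (fun t => f t `^ a * g t `^ (1 - a)).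
  apply: measurable_funM.
    exact: (measurableT_comp (measurable_powR _)).
  exact: (measurableT_comp (measurable_powR _)).
have k1 : 0 <= a * c `^ (a - 1) by rewrite mulr_ge0 ?powR_ge0// ltW.
have k2 : 0 <= (a - 1) * c `^ a by rewrite mulr_ge0 ?powR_ge0// subr_ge0 ltW.
set I := (X in (_ <= X)%E).
(* All terms are kept nonnegative, so no difference of extended reals arises; [I] may be
   infinite. *)
have ineq : ((a * c `^ (a - 1) * x)%:E <= I + ((a - 1) * c `^ a * y)%:E)%E.
  rewrite !EFinM -fx -gy -EFinM -[in leRHS]EFinM -!ge0_integralZl//=; last first.
  - by move=> t _; rewrite lee_fin ltW.
  - exact/measurable_EFinP.
  - by move=> t _; rewrite lee_fin ltW.
  - exact/measurable_EFinP.
  rewrite -ge0_integralD//=; last first.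
  - by apply/measurable_EFinP; exact: measurable_funM.
  - by move=> t _; rewrite lee_fin mulr_ge0// ltW.
  - exact/measurable_EFinP.
  - by move=> t _; rewrite lee_fin mulr_ge0 ?powR_ge0.
  apply: ge0_le_integral => //=.
  - by move=> t _; rewrite lee_fin mulr_ge0// ltW.
  - by apply/measurable_EFinP; exact: measurable_funM.
  - apply/measurable_EFinP/measurable_funD => //.
    exact: measurable_funM.
  - by move=> t _; rewrite lee_fin powR_perspective.
have xE : x = c * y by rewrite divfK// gt_eqF.
have -> : x `^ a * y `^ (1 - a) = c `^ a * y.
  rewrite xE powRM ?ltW// -mulrA -powRD; last by rewrite (gt_eqF y0) implybT.
  by rewrite (addrC a) subrK powRr1// ltW.
move: ineq; rewrite {1}xE -(@mulr_powRB1 _ c a) ?(ltW c0)//.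
case: I => [r| |]; rewrite ?leey// -EFinD !lee_fin.
by move: (c `^ _) => e; lra.
Qed.

Lemma integral_pos_gt0 {d : measure_display} {T : measurableType d}
    (P : probability T R) (f : T -> R) :
  measurable_fun setT f -> (forall t, 0 < f t) -> (0 < \int[P]_t (f t)%:E)%E.
Proof.
move=> mf f0; rewrite lt0e integral_ge0 ?andbT; last first.
  by move=> t _; rewrite lee_fin ltW.
apply/eqP => If0.
have : ae_eq P setT (EFin \o f) (cst 0%E).
  apply/ae_eq_integral_abs => //; first exact/measurable_EFinP.
  by rewrite -[RHS]If0; apply: eq_integral => t _ /=; rewrite ger0_norm// ltW.
move=> [N [mN N0 sub]].
have : P setT = 0%E.
  apply: (subset_measure0 _ mN) => // t _; apply: sub => /= /(_ I) [].
  by apply/eqP; rewrite gt_eqF.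
by rewrite probability_setT => /eqP; rewrite onee_eq0.
Qed.

End renyi_convexity.

(** * Powers and products of Gaussian densities *)

Section gauss.
Local Open Scope classical_set_scope.
Context {R : realType} (s2 : R).
Notation leb := (@lebesgue_measure R).
Hypothesis s20 : 0 < s2.

Let gauss_peak_gt0 : 0 < (Num.sqrt (2 * pi) * Num.sqrt s2)^-1 :> R.
Proof. by rewrite invr_gt0 mulr_gt0// sqrtr_gt0// mulr_gt0// pi_gt0. Qed.

Lemma gauss_gt0 z : 0 < gauss s2 z.
Proof. by rewrite mulr_gt0// expR_gt0. Qed.

Lemma gauss_le_peak z : gauss s2 z <= (Num.sqrt (2 * pi) * Num.sqrt s2)^-1.
Proof.
rewrite ler_piMr ?(ltW gauss_peak_gt0)// -[leRHS]expR0 ler_expR mulNr oppr_le0.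
by rewrite divr_ge0 ?sqr_ge0// mulr_ge0// ltW.
Qed.

Lemma measurable_gauss : measurable_fun setT (gauss s2).
Proof.
apply: measurable_funM => //; apply: measurableT_comp => //.
by apply: measurable_funM => //; apply: measurableT_comp.
Qed.

Lemma integral_gauss_shift m : (\int[leb]_y (gauss s2 (y - m))%:E = 1)%E.
Proof.
rewrite -(integral_normal_pdf m (Num.sqrt s2)); apply: eq_integral => y _.
rewrite normal_pdfE ?gt_eqF ?sqrtr_gt0// /normal_fun sqr_sqrtr ?(ltW s20)//.
rewrite /gauss /normal_peak sqr_sqrtr ?(ltW s20)// -sqrtrM ?mulr_ge0 ?pi_ge0//.
congr (_%:E); congr (_ * _); first by congr (_^-1); congr Num.sqrt; ring.
by congr expR; rewrite -(mulr_natl s2).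
Qed.

(** Completing the square: the weights [a] and [1 - a] sum to one, so the variance stays [s2] and
    only a factor free of [y] is left over. *)
Lemma gauss_powR_mul (a x x' y : R) :
  gauss s2 (y - x) `^ a * gauss s2 (y - x') `^ (1 - a) =
  expR (a * (a - 1) * (x - x') ^+ 2 / (2 * s2)) *
  gauss s2 (y - (a * x + (1 - a) * x')).
Proof.
(* With the normalizing constant inside the exponential, powers act linearly on the exponent. *)
have gaussE z : gauss s2 z =
    expR (ln (Num.sqrt (2 * pi) * Num.sqrt s2)^-1 - z ^+ 2 / (2 * s2)).
  by rewrite expRD lnK ?posrE// -mulNr.
rewrite !gaussE; move: (ln _) => k.
rewrite -!expRM -!expRD; congr expR; field.
by rewrite gt_eqF.
Qed.

Lemma integral_gauss_powR_mul (a x x' : R) :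
  (\int[leb]_y (gauss s2 (y - x) `^ a * gauss s2 (y - x') `^ (1 - a))%:E =
   (expR (a * (a - 1) * (x - x') ^+ 2 / (2 * s2)))%:E)%E.
Proof.
under eq_integral do rewrite gauss_powR_mul EFinM.
rewrite ge0_integralZl//.
- by rewrite integral_gauss_shift mule1.
- apply/measurable_EFinP; apply: (measurableT_comp measurable_gauss).
  exact: measurable_funB.
- by move=> y _; rewrite lee_fin ltW// gauss_gt0.
Qed.

End gauss.

Lemma measurable_expR_sqrB {R : realType} {d : measure_display}
    {T : measurableType d} (D : set T) (f g : T -> R) (k s : R) :
  measurable_fun D f -> measurable_fun D g ->
  measurable_fun D (fun u => expR (k * (f u - g u) ^+ 2 / s)).
Proof.
move=> mf mg; apply: measurableT_comp => //; apply: measurable_funM => //.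
by apply: measurable_funM => //; apply: measurable_funX; exact: measurable_funB.
Qed.

(** * Rényi integral of the Gaussian convolutions *)

Section gauss_convolution.
Local Open Scope classical_set_scope.
Context {R : realType} (s2 : R).
Notation leb := (@lebesgue_measure R).
Notation unif01 := (uniform_prob (@ltr01 R)).
Hypothesis s20 : 0 < s2.

Let measurable_gauss_quantile {p : R -> R} (pd : is_density p) :
  measurable_fun setT
    (fun z : measurableTypeR R * measurableTypeR R =>
      gauss s2 (z.1 - quantile01 pd z.2)).
Proof.
apply: (measurableT_comp (measurable_gauss s2)).
apply: measurable_funB; first exact: measurable_fst.
by apply: measurableT_comp; [exact: measurable_quantile01|exact: measurable_snd].
Qed.

(** Change of variables along the quantile; the Gaussian peak bounds the mean, so [fine] in
    [conv_density] discards nothing. *)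
Lemma conv_gaussE {p : R -> R} (pd : is_density p) y :
  (\int[unif01]_u (gauss s2 (y - quantile01 pd u))%:E =
   (conv_density (gauss s2) p y)%:E)%E.
Proof.
have mg : measurable_fun setT (fun x : R => (gauss s2 (y - x))%:E).
  apply/measurable_EFinP/(measurableT_comp (measurable_gauss s2)).
  exact: measurable_funB.
have g0 x : (0 <= (gauss s2 (y - x))%:E)%E by rewrite lee_fin ltW// gauss_gt0.
rewrite /conv_density; under [in RHS]eq_integral do rewrite EFinM.
rewrite -(integral_quantile01 pd _ mg)// fineK// ge0_fin_numE ?integral_ge0//.
set K : R := (Num.sqrt (2 * pi) * Num.sqrt s2)^-1.
apply: (@le_lt_trans _ _ (\int[unif01]_u K%:E)%E); last first.
  by rewrite integral_cst// [X in (_ * X)%E]probability_setT mule1 ltry.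
apply: ge0_le_integral => //.
- apply/measurable_EFinP.
  exact: (measurable_fun_pair2 y (measurable_gauss_quantile pd)).
- by move=> u _; rewrite lee_fin gauss_le_peak.
Qed.

Lemma conv_gauss_gt0 {p : R -> R} (pd : is_density p) y :
  0 < conv_density (gauss s2) p y.
Proof.
rewrite -lte_fin -(conv_gaussE pd); apply: integral_pos_gt0.
  exact: (measurable_fun_pair2 y (measurable_gauss_quantile pd)).
by move=> u; exact: gauss_gt0.
Qed.

Lemma measurable_conv_gauss {p : R -> R} (pd : is_density p) :
  measurable_fun setT (conv_density (gauss s2) p).
Proof.
apply/measurable_EFinP.
rewrite (_ : EFin \o _ = fubini_F unif01
  (fun z : measurableTypeR R * measurableTypeR R =>
    (gauss s2 (z.1 - quantile01 pd z.2))%:E)); last first.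
  by apply/funext => y; exact: (esym (conv_gaussE pd y)).
apply: measurable_fun_fubini_tonelli_F.
  by apply/measurable_EFinP; exact: (measurable_gauss_quantile pd).
by move=> z; rewrite lee_fin ltW// gauss_gt0.
Qed.

(** Both densities are means over the same uniform variable, which is how the comonotone coupling
    enters. *)
Lemma renyi_integral_conv_gauss_le (a : R) {p q : R -> R} :
  1 < a -> is_density p -> is_density q ->
  (\int[leb]_y (conv_density (gauss s2) p y `^ a *
                conv_density (gauss s2) q y `^ (1 - a))%:E <=
   comonotone_integral p q
     (fun x x' => expR (a * (a - 1) * (x - x') ^+ 2 / (2 * s2))))%E.
Proof.
move=> a1 pd qd.
pose k (z : measurableTypeR R * measurableTypeR R) :=
  (gauss s2 (z.1 - quantile01 pd z.2) `^ a *
   gauss s2 (z.1 - quantile01 qd z.2) `^ (1 - a))%:E.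
have k0 z : (0 <= k z)%E by rewrite lee_fin mulr_ge0 ?powR_ge0.
have mk : measurable_fun setT k.
  apply/measurable_EFinP/measurable_funM.
    exact: (measurableT_comp (measurable_powR _)).
  exact: (measurableT_comp (measurable_powR _)).
apply: (@le_trans _ _ (\int[leb]_y \int[unif01]_u k (y, u))%E).
  apply: ge0_le_integral => //.
  - by move=> y _; rewrite lee_fin mulr_ge0 ?powR_ge0.
  - apply/measurable_EFinP/measurable_funM.
      exact: (measurableT_comp (measurable_powR _) (measurable_conv_gauss pd)).
    exact: (measurableT_comp (measurable_powR _) (measurable_conv_gauss qd)).
  - exact: measurable_fun_fubini_tonelli_F.
  move=> y _; apply: powR_perspective_integral => //.
  - exact: conv_gauss_gt0.
  - exact: conv_gauss_gt0.
  - exact: (measurable_fun_pair2 y (measurable_gauss_quantile pd)).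
  - exact: (measurable_fun_pair2 y (measurable_gauss_quantile qd)).
  - by move=> u; exact: gauss_gt0.
  - by move=> u; exact: gauss_gt0.
  - exact: conv_gaussE.
  - exact: conv_gaussE.
rewrite (fubini_tonelli k)//.
under eq_integral do rewrite /k/= integral_gauss_powR_mul//.
rewrite integral_unif01//; last first.
  by apply/measurable_EFinP/measurable_expR_sqrB; exact: measurable_quantile01.
(* On []0, 1[] the cut-off quantile is the quantile itself. *)
rewrite le_eqVlt; apply/orP; left; apply/eqP; apply: eq_integral => u u01.
by rewrite /quantile01 !patchE u01.
Qed.

End gauss_convolution.

(** * Calibration of the noise variance *)

Theorem theorem2 (R : realType) (Sec Prior : Type) (SS : Sec -> Sec -> Prop)
    (pX : Sec -> Prior -> R -> R) (eps alpha : R)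
    (sig2 : Sec -> Sec -> Prior -> R) (s2 : R) :
  0 < eps -> 1 < alpha ->
  (forall s rho, is_density (pX s rho)) ->
  (forall si sj rho, SS si sj ->
     0 < sig2 si sj rho /\
     comonotone_integral (pX si rho) (pX sj rho)
       (fun x x' => expR (alpha * (alpha - 1) * (x - x') ^+ 2
                          / (2 * sig2 si sj rho)))
     = (expR ((alpha - 1) * eps))%:E) ->
  (* s2 is the maximum of sig2 over all pairs in SS and all priors *)
  (forall si sj rho, SS si sj -> sig2 si sj rho <= s2) ->
  (exists si sj rho, SS si sj /\ sig2 si sj rho = s2) ->
  renyi_pufferfish SS
    (fun s rho => conv_density (gauss s2) (pX s rho)) alpha eps.
Proof.
move=> _ a1 dX sig2P sig2_le _ rho si sj Sij.
have [sij0 sijE] := sig2P _ _ rho Sij; have sij_le := sig2_le _ _ rho Sij.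
have s20 : 0 < s2 by rewrite (lt_le_trans sij0).
have am1 : 0 < alpha - 1 by rewrite subr_gt0.
split.
  rewrite /abs_cont (_ : mkset _ = set0); first exact: negligible_set0.
  rewrite -subset0 => y [/eqP]; rewrite gt_eqF//; exact: conv_gauss_gt0.
have := renyi_integral_conv_gauss_le _ s20 _ a1 (dX si rho) (dX sj rho).
rewrite /renyi_div; move: (integral _ _ _) => I Ile.
(* Raising the variance from [sig2 si sj rho] to [s2] can only lower the exponent, whose numerator
   is nonnegative. *)
have : (I <= (expR ((alpha - 1) * eps))%:E)%E.
  rewrite -sijE; apply: (le_trans Ile).
  apply: ge0_le_integral => //=.
  - by apply/measurable_EFinP/measurable_expR_sqrB; exact: measurable_quantile.
  - by apply/measurable_EFinP/measurable_expR_sqrB; exact: measurable_quantile.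
  - move=> u _; rewrite lee_fin ler_expR ler_wpM2l//.
      by rewrite mulr_ge0 ?sqr_ge0// mulr_ge0// ltW// (lt_trans ltr01).
    by rewrite lef_pV2 ?posrE ?mulr_gt0// ler_pM2l.
(* The bound excludes [+oo], and a divergence of [-oo] is trivially small; for [r > 0], take
   logarithms. *)
case: I {Ile} => [r| |]; rewrite ?leye_eq ?leNye// lee_fin => rle.
case: ifPn => [r0|_]; rewrite ?leNye// lee_fin ler_pdivrMr// mulrC.
by rewrite -ler_expR lnK ?posrE.
Qed.
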